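(* The lifting map $\tilde\rho:\Lambda(\mathbf x)\to\Pi(\mathbf x)$ is an isometry: $\langle f,g\rangle=\langle\tilde\rho(f),\tilde\rho(g)\rangle$ for all $f,g\in\Lambda(\mathbf x)$, where on the left is the standard inner product on $\Lambda(\mathbf x)$ (defined by $\langle m_\lambda,h_\mu\rangle=\delta_{\lambda,\mu}$) and on the right the bilinear form on $\Pi(\mathbf x)$ defined by $\langle m_\pi,h_\sigma\rangle=n!\delta_{\pi,\sigma}$ for $\pi$ a set partition of $[n]$ (zero when $\pi,\sigma$ partition different sets).
   Context: $\Lambda(\mathbf x)$ is the algebra of ordinary symmetric functions with monomial and complete homogeneous bases $m_\lambda,h_\lambda$. $\Pi(\mathbf{x})$ is the algebra of elements of bounded degree in $\mathbb{Q}\langle\langle x_1,x_2,\ldots\rangle\rangle$ (formal power series in noncommuting variables) invariant under all permutations of the variables. For a set partition $\pi$ of $[n]$, $m_\pi=\sum x_{i_1}\cdots x_{i_n}$ over all $n$-tuples of positive integers with $i_j=i_k$ if and only if $j,k$ lie in the same block of $\pi$. For $f:[n]\to\{x_1,x_2,\ldots\}$ let $\ker f$ be the set partition whose blocks are the nonempty fibers of $f$, and $M_f=f(1)\cdots f(n)$; then $h_\pi=\sum_{(f,L)}M_f$ over all pairs with $f:[n]\to\{x_1,\dots\}$ and $L$ a choice of linear ordering of the elements of each block of $(\ker f)\wedge\pi$ (meet in the refinement order). The lifting map is the linear map $\tilde\rho(m_\lambda)=\frac{\lambda!}{n!}\sum_{\lambda(\pi)=\lambda}m_\pi$ for $\lambda\vdash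 n$, where $\lambda(\pi)$ is the type (block-size partition) of $\pi$ and $\lambda!=\prod_j\lambda_j!$. *)

(* Defs.v *)
From HB Require Import structures.
From mathcomp Require Import all_boot all_order all_algebra.
From mathcomp Require Import finmap multiset.
From mathcomp Require Import boolp classical_sets functions cardinality fsbigop.

Set Implicit Arguments.
Unset Strict Implicit.
Unset Printing Implicit Defensive.

Import GRing.Theory.
Local Open Scope ring_scope.

(* The variables x_1, x_2, ... are indexed by nat (from 0).  A monomial in
   commuting variables is a finite multiset of variables, a monomial in
   noncommuting variables is a word; a formal power series is its family of
   coefficients. *)
Notation monomial := {mset nat}%mset.
Notation word := (seq nat).
Notation comm_series := (monomial -> rat^o).
Notation nc_series := (word -> rat^o).

Definition mdegree (m : monomial) : nat := size (enum_mset m).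

Definition perm_monomial (s : nat -> nat) (m : monomial) : monomial :=
  seq_mset [seq s x | x <- enum_mset m].

(* (f * g)_m is the sum of f_a * g_b over the finitely many (a, b) with
   x^a x^b = x^m. *)
Definition cmul (f g : comm_series) : comm_series := fun m =>
  \sum_(ab \in [set ab : monomial * monomial | (ab.1 `+` ab.2)%mset = m]%classic)
    (f ab.1 * g ab.2).

Definition cone : comm_series := fun m => (m == mset0)%:R.

Definition is_symmetric : {pred comm_series} := fun f =>
  `[< (exists d, forall m, (d < mdegree m)%N -> f m = 0) /\
      (forall s, bijective s -> forall m, f (perm_monomial s m) = f m) >].

Definition is_nc_symmetric : {pred nc_series} := fun f =>
  `[< (exists d, forall w : word, (d < size w)%N -> f w = 0) /\
      (forall s, bijective s -> forall w, f [seq s x | x <- w] = f w) >].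

Fact is_symmetric_submod : submod_closed is_symmetric.
Proof.
split=> [|a f g /asboolP[[d fd] fs] /asboolP[[e ge] gs]].
  by apply/asboolP; split; [exists 0%N|].
apply/asboolP; split=> [|s sb m].
  exists (maxn d e) => m; rewrite gtn_max => /andP[dm em].
  have -> : (a *: f + g) m = (a * f m + g m)%R by [].
  by rewrite fd// ge// mulr0; exact: addr0.
have E m' : (a *: f + g) m' = (a * f m' + g m')%R by [].
by rewrite !E fs// gs.
Qed.

Fact is_nc_symmetric_submod : submod_closed is_nc_symmetric.
Proof.
split=> [|a f g /asboolP[[d fd] fs] /asboolP[[e ge] gs]].
  by apply/asboolP; split; [exists 0%N|].
apply/asboolP; split=> [|s sb m].
  exists (maxn d e) => m; rewrite gtn_max => /andP[dm em].
  have -> : (a *: f + g) m = (a * f m + g m)%R by [].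
  by rewrite fd// ge// mulr0; exact: addr0.
have E m' : (a *: f + g) m' = (a * f m' + g m')%R by [].
by rewrite !E fs// gs.
Qed.

HB.instance Definition _ :=
  GRing.isSubmodClosed.Build rat comm_series is_symmetric is_symmetric_submod.
HB.instance Definition _ :=
  GRing.isSubmodClosed.Build rat nc_series is_nc_symmetric
    is_nc_symmetric_submod.

Record Lambda := MkLambda {
  Lambda_series :> comm_series;
  LambdaP : Lambda_series \in is_symmetric }.

HB.instance Definition _ := [isSub for Lambda_series].
HB.instance Definition _ := [Choice of Lambda by <:].
HB.instance Definition _ := [SubChoice_isSubLmodule of Lambda by <:].

Record Pi := MkPi {
  Pi_series :> nc_series;
  PiP : Pi_series \in is_nc_symmetric }.

HB.instance Definition _ := [isSub for Pi_series].
HB.instance Definition _ := [Choice of Pi by <:].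
HB.instance Definition _ := [SubChoice_isSubLmodule of Pi by <:].

Definition is_intpart (n : nat) (la : seq nat) : bool :=
  [&& sorted geq la, 0%N \notin la & sumn la == n].

Definition part_fact (la : seq nat) : nat := (\prod_(j <- la) j`!)%N.

Definition exponents (m : monomial) : seq nat :=
  sort geq [seq m x | x <- finsupp m].

Definition m_series (la : seq nat) : comm_series :=
  fun m => (exponents m == la)%:R.

Definition hn_series (n : nat) : comm_series := fun m => (mdegree m == n)%:R.

Definition h_series (la : seq nat) : comm_series :=
  \big[cmul/cone]_(n <- la) hn_series n.

Lemma perm_monomialE s m x : injective s -> perm_monomial s m (s x) = m x.
Proof.
move=> s_inj; rewrite mset_seqE count_map -[RHS]count_mem_mset.
by apply: eq_count => y /=; rewrite (inj_eq s_inj).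
Qed.

Lemma perm_monomialD s m m' : injective s ->
  perm_monomial s (m `+` m')%mset =
  (perm_monomial s m `+` perm_monomial s m')%mset.
Proof.
move=> s_inj; apply/msetP => x; rewrite msetE2 !mset_seqE !count_map.
rewrite -count_cat; apply/permP/allP => y _ /=.
by rewrite count_cat !count_mem_mset msetE2.
Qed.

Lemma perm_monomialK s t : cancel s t ->
  cancel (perm_monomial s) (perm_monomial t).
Proof.
move=> sK m; have /permP eqs := perm_eq_seq_mset [seq s x | x <- enum_mset m].
apply/msetP => x; rewrite mset_seqE count_map eqs count_map -count_mem_mset.
by apply: eq_count => y /=; rewrite sK.
Qed.

Lemma perm_monomial_bij s : bijective s -> bijective (perm_monomial s).
Proof. by case=> t sK tK; exists (perm_monomial t); exact: perm_monomialK. Qed.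

Lemma mdegree_perm s m : mdegree (perm_monomial s m) = mdegree m.
Proof.
by rewrite /mdegree (perm_size (perm_eq_seq_mset _)) size_map.
Qed.

Lemma mdegreeD m m' : mdegree (m `+` m')%mset = (mdegree m + mdegree m')%N.
Proof.
rewrite /mdegree -size_cat; apply/perm_size/allP => y _ /=.
by rewrite count_cat !count_mem_mset msetE2.
Qed.

Lemma mdegree_exponents m : mdegree m = sumn (exponents m).
Proof.
rewrite /mdegree size_mset sumnE /exponents.
by rewrite (perm_big _ (permEl (perm_sort geq _))) big_map.
Qed.

Lemma exponents_perm s m : injective s ->
  exponents (perm_monomial s m) = exponents m.
Proof.
move=> s_inj; apply/perm_sortP; [exact: (fun x y => leq_total y x)|exact: (fun y x z xy yz => leq_trans yz xy)| |].
  by move=> x y /andP[yx xy]; apply/eqP; rewrite eqn_leq; apply/andP.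
have -> : [seq m x | x <- finsupp m] =
    [seq perm_monomial s m x | x <- [seq s x | x <- finsupp m]].
  by rewrite -map_comp; apply: eq_map => x /=; rewrite perm_monomialE.
apply/perm_map/uniq_perm; rewrite ?map_inj_uniq ?fset_uniq// => x.
rewrite msuppE -mset_gt0 mset_seqE -has_count has_pred1.
by apply/mapP/mapP => -[y ym ->]; exists y => //; move: ym; rewrite msuppE.
Qed.

Fact m_series_symmetric la : m_series la \in is_symmetric.
Proof.
apply/asboolP; split=> [|s /bij_inj s_inj m].
  exists (sumn la) => m; rewrite mdegree_exponents /m_series.
  by case: eqP => [->|//]; rewrite ltnn.
by rewrite /m_series exponents_perm.
Qed.

Fact cmul_symmetric f g : f \in is_symmetric -> g \in is_symmetric ->
  cmul f g \in is_symmetric.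
Proof.
move=> /asboolP[[d fd] fs] /asboolP[[e ge] gs]; apply/asboolP; split=> [|s sb m].
  exists (d + e)%N => m dem; apply: fsbig1 => -[a b] /= abm.
  have [da|ad] := ltnP d (mdegree a); first by rewrite fd ?mul0r.
  rewrite (ge b) ?mulr0// ltnNge; apply/negP => be.
  by move: dem; rewrite -abm mdegreeD ltnNge leq_add.
have s_inj := bij_inj sb; have [s' s'K sK'] := sb.
pose h (ab : monomial * monomial) := (perm_monomial s ab.1, perm_monomial s ab.2).
rewrite /cmul (reindex_fsbig h [set ab | (ab.1 `+` ab.2)%mset = m]%classic)/=.
  by apply: eq_fsbigr => -[a b] _; rewrite /= fs// gs.
have ps := perm_monomialK s'K; have ps' := perm_monomialK sK'.
split=> [[a b] /= <-|[a b] [a' b'] _ _ [] /(can_inj ps)-> /(can_inj ps)->//|].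
  by rewrite perm_monomialD.
move=> [a b] /= abm; exists (perm_monomial s' a, perm_monomial s' b) => /=.
  by rewrite -perm_monomialD ?abm ?ps//; exact: can_inj sK'.
by rewrite /h /= !ps'.
Qed.

Fact h_series_symmetric la : h_series la \in is_symmetric.
Proof.
rewrite /h_series; elim/big_rec: _ => [|n f _ f_sym].
  apply/asboolP; split=> [|s sb m].
    exists 0%N => m; rewrite /cone lt0n /mdegree size_mset_eq0.
    by move/negPf->.
  by rewrite /cone -!size_mset_eq0 -/(mdegree _) mdegree_perm.
apply: cmul_symmetric f_sym; apply/asboolP; split=> [|s sb m].
  by exists n => m; rewrite /hn_series; case: eqP => [->|//]; rewrite ltnn.
by rewrite /hn_series mdegree_perm.
Qed.

Definition m_sym (la : seq nat) : Lambda := MkLambda (m_series_symmetric la).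

Definition h_sym (la : seq nat) : Lambda := MkLambda (h_series_symmetric la).

(* partition is qualified because classical_sets has its own partition. *)
Definition is_set_partition n (P : {set {set 'I_n}}) : bool :=
  finset.partition P [set: 'I_n]%SET.

Definition set_part_type n (P : {set {set 'I_n}}) : seq nat :=
  sort geq [seq #|B : {set 'I_n}| | B <- enum P].

Definition meet_part n (P Q : {set {set 'I_n}}) : {set {set 'I_n}} :=
  ([set B :&: C | B in P, C in Q] :\ finset.set0)%SET.

(* The kernel of the function [n] -> {x_1, x_2, ...} whose successive values
   are the letters of w; only meaningful when size w = n. *)
Definition word_ker n (w : word) : {set {set 'I_n}} :=
  preim_partition (fun i : 'I_n => nth 0%N w i) [set: 'I_n]%SET.

Definition mP_series n (P : {set {set 'I_n}}) : nc_series :=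
  fun w => ((size w == n) && (word_ker n w == P))%:R.

(* A linear order on B is given as the increasing listing of its elements. *)
Definition linear_orders n (B : {set 'I_n}) : {set n.-bseq 'I_n} :=
  [set t : n.-bseq 'I_n | perm_eq t (enum B)].

(* A choice of a linear order L B on each block B of P; the function L takes
   the dummy value [bseq] outside P. *)
Definition block_orders n (P : {set {set 'I_n}}) :
    {set {ffun {set 'I_n} -> n.-bseq 'I_n}} :=
  [set L : {ffun {set 'I_n} -> n.-bseq 'I_n} |
    [forall B, if B \in P then L B \in linear_orders B else L B == [bseq]]].

(* Since M_f determines f, the coefficient of w in the sum of M_f over all
   pairs (f, L) is the number of L for the only f with M_f = w. *)
Definition hP_series n (P : {set {set 'I_n}}) : nc_series :=
  fun w => if size w == n then #|block_orders (meet_part (word_ker n w) P)|%:R else 0.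

Lemma word_ker_map n s w : injective s -> size w = n ->
  word_ker n [seq s x | x <- w] = word_ker n w.
Proof.
move=> s_inj sw; apply: eq_in_imset => i _; apply/setP => j.
by rewrite !inE /= !(nth_map 0%N) ?sw// (inj_eq s_inj).
Qed.

Fact mP_series_symmetric n (P : {set {set 'I_n}}) :
  mP_series P \in is_nc_symmetric.
Proof.
apply/asboolP; split=> [|s /bij_inj s_inj w].
  by exists n => w; rewrite /mP_series; case: eqP => [->|//]; rewrite ltnn.
rewrite /mP_series size_map; case: eqP => //= sw.
by rewrite word_ker_map.
Qed.

Fact hP_series_symmetric n (P : {set {set 'I_n}}) :
  hP_series P \in is_nc_symmetric.
Proof.
apply/asboolP; split=> [|s /bij_inj s_inj w].
  by exists n => w; rewrite /hP_series; case: eqP => [->|//]; rewrite ltnn.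
rewrite /hP_series size_map; case: eqP => //= sw.
by rewrite word_ker_map.
Qed.

Definition m_nc n (P : {set {set 'I_n}}) : Pi := MkPi (mP_series_symmetric P).

Definition h_nc n (P : {set {set 'I_n}}) : Pi := MkPi (hP_series_symmetric P).

(* Main.v *)
(* The lift of f has coefficient f(x^w) / #(rearrangements of w) at the word w:
   the coefficient of f is spread evenly over the words with a given content.
   Fix a partition mu of n and average h_pi over the set partitions pi of type
   mu; since these form one orbit of the symmetric group, this amounts to fixing
   pi (with interval blocks) and averaging over the rearrangements of the word.
   The sum of the coefficients of h_pi over the words with content m is
   mu! h_mu(m), so the lift of h_mu is the sum of the h_pi divided by mu! times
   the number of set partitions of type mu.  The duality of the m_pi and h_pi
   then gives <lift m_la, lift h_mu> = delta.  Finally, the duality of m_la and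
   h_mu makes the transition matrix from m to h inverse, up to transposition, to
   the Gram matrix of either form on the m_la, so the two forms agree there. *)

Require Import Defs.
From mathcomp Require Import all_boot all_algebra perm fingroup.
From mathcomp Require Import finmap multiset ring.
From mathcomp Require Import boolp classical_sets functions fsbigop.

Set Implicit Arguments.
Unset Strict Implicit.
Unset Printing Implicit Defensive.

Import GRing.Theory Num.Theory.

(** * Factorials of letter multiplicities and the number of rearrangements of a word *)

Section MultFact.
Variable T : eqType.
Implicit Types s t r : seq T.

(** This is the order of the stabilizer of the word [s] under permutation of its positions. On a
    word of pairs it is the product of the block factorials of the meet of two kernels. *)
Definition mult_fact s : nat := \prod_(z <- undup s) (count_mem z s)`!.

(** Absent letters contribute [0! = 1], so words with different letters can be compared over a
    common index list. *)
Lemma mult_fact_subset s r : uniq r -> {subset s <= r} ->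
  mult_fact s = \prod_(z <- r) (count_mem z s)`!.
Proof.
move=> r_uniq sr; rewrite /mult_fact.
rewrite (@perm_big _ _ _ _ _ [seq z <- r | z \in s]); last first.
  apply: uniq_perm => [||z]; rewrite ?undup_uniq ?filter_uniq //.
  by rewrite mem_undup mem_filter; case: (boolP (z \in s)) => // /sr ->.
rewrite big_filter big_mkcond; apply: eq_bigr => z _.
by case: ifPn => // /count_memPn ->.
Qed.

Lemma perm_mult_fact s t : perm_eq s t -> mult_fact s = mult_fact t.
Proof.
move=> st; rewrite (@mult_fact_subset s (undup t)) ?undup_uniq //.
  by apply: eq_bigr => z _; rewrite (seq.permP st).
by move=> z; rewrite mem_undup (perm_mem st).
Qed.

Lemma mult_fact_cat s t : ~~ has (mem s) t ->
  mult_fact (s ++ t) = mult_fact s * mult_fact t.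
Proof.
move=> st; rewrite (@mult_fact_subset _ (undup s ++ undup t)).
- rewrite big_cat; congr (_ * _); apply: eq_big_seq => z; rewrite mem_undup => zs.
    rewrite count_cat (count_memPn (_ : z \notin t)) ?addn0 //.
    by apply: contra st => zt; apply/hasP; exists z.
  rewrite count_cat (count_memPn (_ : z \notin s)) //.
  by apply: contra st => zt; apply/hasP; exists z.
- rewrite cat_uniq !undup_uniq andbT; apply: contra st => /hasP[z].
  by rewrite mem_undup /= mem_undup => ? ?; apply/hasP; exists z.
by move=> z; rewrite !mem_cat !mem_undup.
Qed.

Lemma mult_fact_cons x s : mult_fact (x :: s) = (count_mem x s).+1 * mult_fact s.
Proof.
have sub : {subset s <= undup (x :: s)} by move=> z zs; rewrite mem_undup inE zs orbT.
rewrite (mult_fact_subset (undup_uniq _) sub) /mult_fact.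
rewrite !(bigD1_seq x) ?undup_uniq ?mem_undup ?mem_head //= eqxx factS mulnA.
congr (_ * _); apply: eq_bigr => z; by rewrite eq_sym => /negPf ->.
Qed.

Lemma sum_count_undup s : \sum_(x <- undup s) count_mem x s = size s.
Proof.
under eq_bigr do rewrite -sum1_count big_mkcond.
rewrite exchange_big /= -sum1_size; apply: eq_big_seq => y ys.
rewrite (bigD1_seq y) ?undup_uniq ?mem_undup //= eqxx.
by rewrite big1 ?addn0 // => i; rewrite eq_sym => /negPf->.
Qed.

(** Orbit-stabilizer for words. By induction: group the rearrangements by first letter [y]; deleting
    one [y] divides [mult_fact] by the multiplicity of [y], and the multiplicities add up to the
    size. *)
Lemma size_permutations_mult_fact s :
  size (permutations s) * mult_fact s = (size s)`!.
Proof.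
have [n] := ubnP (size s); elim: n s => // n IH [|x s] sn.
  by rewrite /mult_fact big_nil.
set u := (x :: s).
rewrite (perm_size (permutationsE _)) // size_allpairs_dep sumnE big_map big_distrl.
transitivity (\sum_(y <- undup u) count_mem y u * (size s)`!).
  apply: eq_big_seq => y; rewrite mem_undup => yu.
  have -> : count_mem y u = (count_mem y (rem y u)).+1.
    by rewrite (seq.permP (perm_to_rem yu)) [LHS]/= eqxx.
  rewrite [LHS]/= (perm_mult_fact (perm_to_rem yu)) mult_fact_cons mulnCA.
  have sz : size (rem y u) = size s by rewrite size_rem.
  by rewrite IH ?sz.
by rewrite -big_distrl sum_count_undup.
Qed.

End MultFact.

Lemma mult_fact_map (T U : eqType) (f : T -> U) s : injective f ->
  mult_fact (map f s) = mult_fact s.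
Proof.
move=> f_inj; rewrite /mult_fact undup_map_inj // big_map; apply: eq_bigr => z _.
by rewrite count_map; congr _`!; apply: eq_count => y /=; rewrite (inj_eq f_inj).
Qed.

(** * Averages over the symmetric group as averages over an orbit *)

(* The first hypothesis makes all the fibers of phi left cosets of the fiber of 1. *)
Lemma sum_perm_fibers n (T : eqType) (V : nmodType) (phi : 'S_n -> T)
    (r : seq T) (G : T -> V) :
  (forall s t, (phi s == phi t) = (phi (t^-1 * s)%g == phi 1%g)) ->
  uniq r -> (forall v, reflect (exists s, v = phi s) (v \in r)) ->
  (\sum_s G (phi s) = (\sum_(v <- r) G v) *+ #|[set s | phi s == phi 1%g]|)%R.
Proof.
move=> phiE r_uniq rP.
have E s : (G (phi s) = \sum_(v <- r | phi s == v) G v)%R.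
  have sr : phi s \in r by apply/rP; exists s.
  rewrite big_mkcond (bigD1_seq (phi s)) //= eqxx.
  by rewrite big1 ?addr0 // => i; rewrite eq_sym => /negPf->.
under eq_bigr do rewrite E.
rewrite (exchange_big_dep xpredT) //= -sumrMnl; apply: eq_big_seq => v /rP[t ->].
rewrite sumr_const; congr (_ *+ _)%R; rewrite cardsE.
rewrite -(card_imset _ (mulgI t^-1%g)); apply: eq_card => s.
apply/imsetP/idP => [[u ut ->]|s1].
  by have: phi u == phi t := ut; rewrite phiE.
exists (t * s)%g; last by rewrite mulKg.
by suff: phi (t * s)%g == phi t by []; rewrite phiE mulKg; exact: s1.
Qed.

(** Taking [G] constantly 1 in [sum_perm_fibers] shows that [n!] is [size r] times the size of a
    fiber. Cross-multiplication avoids division, which [V] need not have. *)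
Lemma sum_perm_fibers_avg n (T : eqType) (V : nmodType) (phi : 'S_n -> T)
    (r : seq T) (G : T -> V) :
  (forall s t, (phi s == phi t) = (phi (t^-1 * s)%g == phi 1%g)) ->
  uniq r -> (forall v, reflect (exists s, v = phi s) (v \in r)) ->
  ((\sum_s G (phi s)) *+ size r = (\sum_(v <- r) G v) *+ n`!)%R.
Proof.
move=> phiE r_uniq rP; rewrite (sum_perm_fibers _ phiE r_uniq rP) -mulrnA.
congr (_ *+ _)%R; have := sum_perm_fibers (fun=> 1) phiE r_uniq rP.
rewrite sum1_card [#|_|]card_Sn => ->.
by rewrite -[X in (X *+ _)%R]/(\sum_(v <- r) 1) sum1_size -mulr_natr natn mulnC.
Qed.

Local Open Scope ring_scope.

(** * Exponents of monomials, and a representative monomial for each integer partition *)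

Lemma sort_geq_perm s t : perm_eq s t -> sort geq s = sort geq t.
Proof.
move=> st; apply/perm_sortP => //.
- by move=> x y; exact: leq_total.
- by move=> y x z xy yz; exact: leq_trans yz xy.
by move=> x y /andP[yx xy]; apply/eqP; rewrite eqn_leq; apply/andP.
Qed.

Lemma exponents_seq_mset (w : seq nat) :
  exponents (seq_mset w) = sort geq [seq count_mem z w | z <- undup w].
Proof.
apply: sort_geq_perm; rewrite (eq_map (mset_seqE w)); apply/perm_map/uniq_perm.
- exact: fset_uniq.
- exact: undup_uniq.
by move=> x; rewrite msuppE (perm_mem (perm_eq_seq_mset w)) mem_undup.
Qed.

Lemma mdegree_seq_mset (w : seq nat) : mdegree (seq_mset w) = size w.
Proof. exact/perm_size/perm_eq_seq_mset. Qed.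

Lemma part_fact_exponents (w : seq nat) :
  part_fact (exponents (seq_mset w)) = mult_fact w.
Proof.
rewrite /part_fact exponents_seq_mset.
by rewrite (perm_big _ (permEl (perm_sort geq _))) big_map.
Qed.

Lemma exponents_intpart (m : monomial) : is_intpart (mdegree m) (exponents m).
Proof.
rewrite /is_intpart -mdegree_exponents eqxx sort_sorted ?andbT /=; last first.
  by move=> x y; exact: leq_total.
rewrite mem_sort; apply/negP => /mapP[x]; rewrite msuppE -mset_gt0.
by move=> + m0; rewrite -m0.
Qed.

Lemma perm_exponents_iota (m : monomial) N : (forall x, N <= x -> m x = 0)%N ->
  perm_eq (exponents m ++ nseq (N - size (exponents m)) 0%N) [seq m x | x <- iota 0 N].
Proof.
move=> mN; set t := map _ _.
have E : perm_eq (exponents m) [seq x <- t | x != 0%N].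
  rewrite perm_sort filter_map; apply/perm_map/uniq_perm => [||x].
  - exact: fset_uniq.
  - exact/filter_uniq/iota_uniq.
  rewrite msuppE -mset_neq0 mem_filter mem_iota /=.
  by case: (ltnP x N) => [|/mN ->]; rewrite ?andbT ?andbF ?eqxx.
have -> : nseq (N - size (exponents m)) 0%N = [seq x <- t | ~~ (x != 0%N)].
  have /all_pred1P -> : all (pred1 0%N) [seq x <- t | ~~ (x != 0%N)].
    by apply/allP => x; rewrite mem_filter negbK => /andP[].
  congr nseq; rewrite (perm_size E) !size_filter -[N in LHS](size_iota 0).
  rewrite -(size_map m) -/t -(count_predC (fun x => x != 0%N)) addKn.
  by [].
by rewrite (permPl (perm_cat E (perm_refl _))) perm_filterC.
Qed.

(** Exponents determine the orbit under renaming of variables. Below a common bound [N] both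
    monomials have the same list of values up to order, zeros included, so a permutation of ['I_N]
    carries one to the other. *)
Lemma exponents_eqP (m m' : monomial) : exponents m = exponents m' ->
  exists2 s, bijective s & perm_monomial s m = m'.
Proof.
move=> mm'; pose N := (\max_(x <- enum_mset m ++ enum_mset m') x).+1.
have bnd (k : monomial) x : {subset enum_mset k <= enum_mset m ++ enum_mset m'} ->
    (N <= x)%N -> k x = 0%N.
  move=> sub Nx; apply/eqP; rewrite mset_eq0; apply/negP => /sub xk.
  by move: Nx; rewrite leqNgt ltnS (leq_bigmax_seq _ xk).
have mN x : (N <= x)%N -> m x = 0%N.
  by apply: bnd => y; rewrite mem_cat => ->.
have m'N x : (N <= x)%N -> m' x = 0%N.
  by apply: bnd => y; rewrite mem_cat orbC => ->.
have := perm_exponents_iota mN; rewrite mm' => /permPl E.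
have := perm_exponents_iota m'N; rewrite E => {}E.
have /tuple_permP[p pE] :
    perm_eq [seq m (val i) | i <- enum 'I_N] [tuple m' (val i) | i < N].
  by rewrite /= (map_comp m val) (map_comp m' val) val_enum_ord.
have {pE} mp (i : 'I_N) : m i = m' (p i).
  have := congr1 (fun s => nth 0%N s i) pE.
  by rewrite -[RHS](@tnth_nth _ _ _ [tuple _ | i < N]) tnth_mktuple tnth_mktuple
      (nth_map i) ?size_enum_ord // nth_ord_enum.
(* The permutation of the first [N] variables is extended by the identity to all of [nat]. *)
pose ext (q : 'S_N) x := if insub x is Some i then val (q i) else x.
have extK (q q' : 'S_N) : cancel q q' -> cancel (ext q) (ext q').
  move=> qK x; rewrite /ext; case: (insubP 'I_N x) => [i _ <-|xN].
    by rewrite valK qK.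
  by rewrite insubN.
have pK := extK _ _ (permK p); have pVK := extK _ _ (permKV p).
exists (ext p); first by exists (ext p^-1%g).
apply/msetP => y; rewrite -(pVK y) perm_monomialE; last exact: can_inj pK.
rewrite pVK /ext; case: (insubP 'I_N y) => [i _ <-|]; first by rewrite mp permKV.
by rewrite -leqNgt => yN; rewrite mN ?m'N.
Qed.

(* block_word mu lists mu_1 copies of size mu - 1, ..., mu_l copies of 0: for an
   integer partition mu its content has exponents mu and its kernel has type mu. *)
Fixpoint block_word (mu : seq nat) : seq nat :=
  if mu is k :: mu' then nseq k (size mu') ++ block_word mu' else [::].

Lemma size_block_word mu : size (block_word mu) = sumn mu.
Proof. by elim: mu => //= k mu IH; rewrite size_cat size_nseq IH. Qed.

Lemma block_word_lt mu x : x \in block_word mu -> (x < size mu)%N.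
Proof.
elim: mu => //= k mu IH; rewrite mem_cat mem_nseq => /orP[/andP[_ /eqP->]//|/IH].
exact: ltnW.
Qed.

Lemma count_block_word mu : 0%N \notin mu ->
  perm_eq [seq count_mem z (block_word mu) | z <- undup (block_word mu)] mu.
Proof.
elim: mu => // k mu IH; rewrite inE negb_or eq_sym -lt0n => /andP[k_gt0 /IH mu_perm].
set c := size mu; set u := block_word mu.
have cu : c \notin u by apply/negP => /block_word_lt; rewrite ltnn.
have E : perm_eq (undup (block_word (k :: mu))) (c :: undup u).
  apply: uniq_perm; rewrite /= ?mem_undup ?cu ?undup_uniq // => x.
  by rewrite inE !mem_undup mem_cat mem_nseq k_gt0.
rewrite (permPl (perm_map _ E)) /= count_cat (count_memPn cu) count_nseq /= eqxx.
rewrite mul1n addn0 perm_cons -(permPr mu_perm).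
rewrite (@eq_in_map _ _ _ (fun z => count_mem z u) (undup u)).1 // => z.
rewrite mem_undup count_cat count_nseq /= => zu.
by case: eqVneq => // cz; rewrite -cz (negPf cu) in zu.
Qed.

Lemma exponents_block_word n mu : is_intpart n mu ->
  exponents (seq_mset (block_word mu)) = mu.
Proof.
case/and3P => mu_sorted mu0 _; rewrite exponents_seq_mset.
rewrite (sort_geq_perm (count_block_word mu0)); apply: sorted_sort => //.
by move=> y x z xy yz; exact: leq_trans yz xy.
Qed.

(** * Set partitions as kernels of words, and the coefficients of [hP_series] *)

Section SetPartitions.
Variables (n : nat) (T : eqType).
Implicit Types g : 'I_n -> T.

(** Indexing the blocks by the values taken turns statements on block sizes into statements on
    letter multiplicities. *)
Lemma perm_enum_preim_partition g :
  perm_eq (enum (preim_partition g [set: 'I_n]%SET))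
    [seq [set i | g i == z]%SET | z <- undup [seq g i | i <- enum 'I_n]].
Proof.
apply: uniq_perm => [||B].
- exact: enum_uniq.
- rewrite map_inj_in_uniq ?undup_uniq // => z z' /[!mem_undup] /mapP[i _ ->] _.
  by move=> /setP/(_ i); rewrite !inE eqxx => /esym/eqP.
rewrite mem_enum; apply/imsetP/mapP => [[i _ ->]|[z]].
  exists (g i); first by rewrite mem_undup map_f ?mem_enum.
  by apply/setP => j; rewrite !inE /= eq_sym.
rewrite mem_undup => /mapP[i _ ->] ->; exists i => //.
by apply/setP => j; rewrite !inE /= eq_sym.
Qed.

Lemma card_fiber g z :
  #|[set i | g i == z]%SET| = count_mem z [seq g i | i <- enum 'I_n].
Proof. by rewrite cardsE -sum1_card -sum1_count big_map big_enum_cond. Qed.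

Lemma set_part_type_preim g : set_part_type (preim_partition g [set: 'I_n]%SET) =
  let w := [seq g i | i <- enum 'I_n] in sort geq [seq count_mem z w | z <- undup w].
Proof.
rewrite /set_part_type /=; apply: sort_geq_perm.
rewrite (permPl (perm_map _ (perm_enum_preim_partition g))) -map_comp.
by rewrite (@eq_map _ _ _ (fun z => count_mem z [seq g i | i <- enum 'I_n])) // => z;
   exact: card_fiber.
Qed.

Lemma prod_fact_preim g :
  (\prod_(B in preim_partition g [set: 'I_n]%SET) #|B| `! =
   mult_fact [seq g i | i <- enum 'I_n])%N.
Proof.
rewrite -big_enum (perm_big _ (perm_enum_preim_partition g)) big_map.
by apply: eq_bigr => z _; rewrite card_fiber.
Qed.

End SetPartitions.

Lemma card_linear_orders n (B : {set 'I_n}) : #|linear_orders B| = #|B| `!.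
Proof.
rewrite cardE -(size_map (fun t : n.-bseq 'I_n => t : seq _)) [#|B|]cardE.
rewrite -(size_permutations (enum_uniq B)); apply/perm_size/uniq_perm.
- by rewrite map_inj_uniq ?enum_uniq //; exact: val_inj.
- exact: permutations_uniq.
move=> s; rewrite mem_permutations; apply/mapP/idP => [[t + ->]|sB].
  by rewrite mem_enum inE.
have sn : (size s <= n)%N.
  by rewrite (perm_size sB) -cardE -[n in (_ <= n)%N]card_ord max_card.
by exists (Bseq sn) => //; rewrite mem_enum inE.
Qed.

(** The functions form a product family; outside [P] only the dummy value is allowed, which gives a
    factor 1. *)
Lemma card_block_orders n (P : {set {set 'I_n}}) :
  #|block_orders P| = (\prod_(B in P) #|B| `!)%N.
Proof.
pose F (B : {set 'I_n}) : pred (n.-bseq 'I_n) :=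
  fun t => if B \in P then t \in linear_orders B else t == [bseq].
transitivity #|(family F : simpl_pred {ffun {set 'I_n} -> n.-bseq 'I_n})|.
  apply: eq_card => L; by rewrite inE; apply: eq_forallb.
rewrite card_family foldrE big_map big_enum /= [RHS]big_mkcond; apply: eq_bigr => B _.
by rewrite /F; case: ifP => _; [exact: card_linear_orders|exact: card1].
Qed.

(** Two positions share a block of the meet exactly when both functions agree on them. For kernels
    of words, the meet is therefore the kernel of the zipped word. *)
Lemma meet_preim_partition n (T U : eqType) (g : 'I_n -> T) (h : 'I_n -> U) :
  meet_part (preim_partition g [set: 'I_n]%SET) (preim_partition h [set: 'I_n]%SET) =
  preim_partition (fun i => (g i, h i)) [set: 'I_n]%SET.
Proof.
apply/setP => B; rewrite !inE; apply/andP/imsetP => [[B0 /imset2P[C D]]|[i _ BE]].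
  move=> /imsetP[i _ CE] /imsetP[j _ DE] BE; have /set0Pn[k kB] := B0.
  move: kB; rewrite {}BE {}CE {}DE => kB; exists k => //.
  move: kB; rewrite !inE /= => /andP[/eqP ik /eqP jk].
  by apply/setP => l; rewrite !inE /= xpair_eqE ik jk.
split; first by apply/set0Pn; exists i; rewrite BE !inE eqxx.
apply/imset2P; exists [set j | g i == g j]%SET [set j | h i == h j]%SET.
- by apply/imsetP; exists i => //; apply/setP => j; rewrite !inE.
- by apply/imsetP; exists i => //; apply/setP => j; rewrite !inE.
by rewrite BE; apply/setP => j; rewrite !inE /= xpair_eqE.
Qed.

Lemma map_nth_enum_ord n (T : Type) (x0 : T) (w : seq T) : size w = n ->
  [seq nth x0 w i | i : 'I_n <- enum 'I_n] = w.
Proof.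
by move=> <-; rewrite (map_comp (nth x0 w)) val_enum_ord -/(mkseq _ _) mkseq_nth.
Qed.

Lemma word_ker_set_partition n w : is_set_partition (word_ker n w).
Proof. exact: preim_partitionP. Qed.

Lemma set_part_type_word_ker n (w : word) : size w = n ->
  set_part_type (word_ker n w) = exponents (seq_mset w).
Proof.
by move=> wn; rewrite set_part_type_preim exponents_seq_mset map_nth_enum_ord.
Qed.

Lemma hP_series_word_ker n (u w : word) : size u = n -> size w = n ->
  hP_series (word_ker n u) w = (mult_fact (zip w u))%:R.
Proof.
move=> un wn; rewrite /hP_series wn eqxx card_block_orders meet_preim_partition.
rewrite prod_fact_preim; congr (_%:R); congr mult_fact.
rewrite -[RHS](@map_nth_enum_ord n _ (0, 0)%N) ?size_zip ?un ?wn ?minnn //.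
by apply: eq_map => i; rewrite nth_zip ?un ?wn.
Qed.

Lemma word_ker_eqP n (u v : word) :
  reflect (forall i j : 'I_n, (nth 0 u i == nth 0 u j) = (nth 0 v i == nth 0 v j))%N
    (word_ker n u == word_ker n v).
Proof.
have eqr (w : word) : {in [set: 'I_n]%SET & &, equivalence_rel
    [rel x y : 'I_n | nth 0%N w x == nth 0%N w y]}.
  by split=> //= /eqP->.
apply: (iffP eqP) => [uv i j|uv].
  have pE (w : word) :
      (j \in finset.pblock (word_ker n w) i) = (nth 0%N w i == nth 0%N w j).
    exact: (pblock_equivalence_partition (eqr w)).
  by rewrite -!pE uv.
by apply: eq_imset => i; apply/setP => j; rewrite !inE /= uv.
Qed.

(** The letter at each position is the rank of its block in [enum P]. *)
Lemma exists_word_ker n (P : {set {set 'I_n}}) : is_set_partition P ->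
  exists2 u : word, size u = n & word_ker n u = P.
Proof.
move=> PP; pose u := [seq index (finset.pblock P i) (enum P) | i <- enum 'I_n].
have un : size u = n by rewrite size_map size_enum_ord.
exists u => //; rewrite -[RHS](preim_partition_pblock PP).
have uE (i : 'I_n) : nth 0%N u i = index (finset.pblock P i) (enum P).
  by rewrite (nth_map i) ?size_enum_ord // nth_ord_enum.
have blk (i : 'I_n) : finset.pblock P i \in enum P.
  by rewrite mem_enum pblock_mem // (cover_partition PP).
apply: eq_imset => i; apply/setP => j; rewrite !inE /= !uE.
apply/eqP/eqP => [/(index_inj finset.set0 (blk i) (blk j))//|-> //].
Qed.

(** * Cutting words into prefix and suffix, and products of complete homogeneous series *)

Lemma partition_big_undup (V : nmodType) (I J : eqType) (r : seq I) (p : I -> J)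
    (F : I -> V) :
  \sum_(i <- r) F i = \sum_(j <- undup [seq p i | i <- r]) \sum_(i <- r | p i == j) F i.
Proof.
rewrite (exchange_big_dep xpredT) //=; apply: eq_big_seq => i ir.
rewrite big_mkcond (bigD1_seq (p i)) ?undup_uniq ?mem_undup ?map_f //= eqxx.
by rewrite big1 ?addr0 // => j; rewrite eq_sym => /negPf->.
Qed.

Definition split_mset k (v : word) : monomial * monomial :=
  (seq_mset (take k v), seq_mset (drop k v)).

Lemma seq_mset_cat (s t : word) :
  seq_mset (s ++ t) = (seq_mset s `+` seq_mset t)%mset.
Proof. by apply/msetP => x; rewrite msetE2 !mset_seqE count_cat. Qed.

Lemma mem_permutations_mset (m : monomial) (v : word) :
  (v \in permutations (enum_mset m)) = (seq_mset v == m).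
Proof.
by rewrite mem_permutations -{2}[m]seq_mset_id; apply/idP/eqP => /eq_seq_msetP.
Qed.

(** A factorization [(a, b)] of [m] with [a] of degree [k] comes from cutting a listing of [a]
    followed by one of [b]; all other pairs have coefficient 0. This reduces the product to a sum
    over a finite list. *)
Lemma cmul_hn_series k (g : comm_series) (m : monomial) :
  cmul (hn_series k) g m =
  \sum_(ab <- undup [seq split_mset k v | v <- permutations (enum_mset m)])
     (mdegree ab.1 == k)%:R * g ab.2.
Proof.
rewrite /cmul; set r := undup _.
have rP ab : ab \in r -> (ab.1 `+` ab.2)%mset = m.
  rewrite mem_undup => /mapP[v]; rewrite mem_permutations_mset => /eqP <- ->.
  by rewrite -seq_mset_cat cat_take_drop.
rewrite (fsbigE r) ?undup_uniq //=.
- rewrite big_mkcond; apply: eq_big_seq => ab /rP abm.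
  by rewrite ifT // inE.
move=> [a b] /= abm abr; rewrite /hn_series; case: eqP => [ak|_]; last by rewrite mul0r.
case/negP: abr; rewrite mem_undup; apply/mapP.
exists (enum_mset a ++ enum_mset b).
  by rewrite mem_permutations_mset seq_mset_cat !seq_mset_id abm.
by rewrite /split_mset -ak take_size_cat // drop_size_cat // !seq_mset_id.
Qed.

Lemma sum_split_mset (V : nmodType) k (a b m : monomial) (G : word -> V) :
  (a `+` b)%mset = m -> mdegree a = k ->
  \sum_(v <- permutations (enum_mset m) | split_mset k v == (a, b)) G v =
  \sum_(v1 <- permutations (enum_mset a)) \sum_(v2 <- permutations (enum_mset b))
     G (v1 ++ v2).
Proof.
move=> abm ak; transitivity (\sum_(v <- [seq v1 ++ v2 |
    v1 <- permutations (enum_mset a), v2 <- permutations (enum_mset b)]) G v);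
  last by rewrite big_allpairs_dep.
rewrite -big_filter; apply: perm_big; apply: uniq_perm.
- exact/filter_uniq/permutations_uniq.
- apply: allpairs_uniq; rewrite ?permutations_uniq // => -[s t] [s' t'] /=.
  move=> /allpairsP[[s1 t1] /= [+ _ [-> _]]] /allpairsP[[s2 t2] /= [+ _ [-> _]]].
  rewrite !mem_permutations => /perm_size s1a /perm_size s2a /eqP.
  by rewrite eqseq_cat ?s1a ?s2a // => /andP[/eqP-> /eqP->].
move=> v; rewrite mem_filter mem_permutations_mset; apply/andP/allpairsP => /=.
  case=> /eqP[va vb] vm; exists (take k v, drop k v).
  by rewrite !mem_permutations_mset va vb !eqxx cat_take_drop.
case=> -[s t] /= []; rewrite !mem_permutations_mset => /eqP sa /eqP tb ->.
rewrite seq_mset_cat sa tb abm; split=> //.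
have sk : size s = k by rewrite -mdegree_seq_mset sa.
by rewrite /split_mset take_size_cat // drop_size_cat // sa tb.
Qed.

(** [mult_fact] is constant on rearrangements, so the sum is orbit size times stabilizer order. *)
Lemma sum_mult_fact_permutations (m : monomial) :
  (\sum_(v <- permutations (enum_mset m)) mult_fact v = (mdegree m)`!)%N.
Proof.
rewrite -(size_permutations_mult_fact (enum_mset m)) -sum1_size big_distrl.
apply: eq_big_seq => v; rewrite mem_permutations /= mul1n; exact: perm_mult_fact.
Qed.

(* Cutting the words with content m after their first k letters realizes the
   product of h_k with the remaining factors. *)
Lemma sum_mult_fact_block_word (mu : seq nat) (m : monomial) :
  \sum_(v <- permutations (enum_mset m))
     (if size v == sumn mu then (mult_fact (zip v (block_word mu)))%:R else 0) =
  (part_fact mu)%:R * h_series mu m.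
Proof.
elim: mu m => [|k mu IH] m.
  rewrite /part_fact /h_series !big_nil mul1r /cone.
  case: (m =P mset0) => [->|/eqP m0].
    by rewrite enum_mset0 big_seq1 /= /mult_fact big_nil.
  rewrite big1_seq // => v /andP[_]; rewrite mem_permutations => /perm_size ->.
  by rewrite size_mset_eq0 (negPf m0).
have -> : h_series (k :: mu) = cmul (hn_series k) (h_series mu) by exact: big_cons.
have -> : part_fact (k :: mu) = (k`! * part_fact mu)%N by exact: big_cons.
rewrite (partition_big_undup _ (split_mset k)) cmul_hn_series mulr_sumr.
apply: eq_big_seq => -[a b]; rewrite mem_undup => /mapP[v0 v0m abE].
have abm : (a `+` b)%mset = m.
  case: abE => -> ->; rewrite -seq_mset_cat cat_take_drop.
  by apply/eqP; rewrite -mem_permutations_mset.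
rewrite /=; case: eqP => [ak|/eqP ak]; last first.
  (* A word of the full length has a prefix of exactly [k] letters, so no such word is cut into a
     first part of another degree. *)
  rewrite mul0r mulr0 big1 // => v /eqP[va _].
  case: eqP => // vk; case/negP: ak.
  by rewrite -va mdegree_seq_mset size_takel // vk leq_addr.
rewrite (sum_split_mset _ abm ak) mul1r natrM -mulrA -IH -ak -sum_mult_fact_permutations.
rewrite natr_sum mulr_suml; apply: eq_big_seq => v1 /=; rewrite mem_permutations.
move=> /perm_size v1k; rewrite mulr_sumr; apply: eq_bigr => v2 _.
rewrite size_cat v1k -/(mdegree a) eqn_add2l; case: eqP => v2k; last by rewrite mulr0.
have v1s : size v1 = size (nseq (mdegree a) (size mu)) by rewrite size_nseq v1k.
(* The letter [size mu] does not occur in [block_word mu], so the two zipped pieces share no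
   pair. *)
rewrite zip_cat // mult_fact_cat; last first.
  apply/hasPn => -[x y] /(map_f snd) /=; rewrite -/(unzip2 _).
  rewrite unzip2_zip ?size_block_word ?v2k //.
  move=> /block_word_lt ylt; apply/negP => /(map_f snd) /=.
  by rewrite -/(unzip2 _) unzip2_zip ?v1s // mem_nseq => /andP[_ /eqP yE];
    rewrite yE ltnn in ylt.
rewrite natrM; congr (_%:R * _).
(* Pairing every letter with one constant letter leaves the multiplicities unchanged. *)
rewrite -(@mult_fact_map _ _ (fun x => (x, size mu)) v1); last by move=> x y [].
rewrite size_nseq in v1s; congr mult_fact; rewrite -v1s.
by elim: (v1) => //= x s ->.
Qed.

(** In the preceding identity every term on the left vanishes, and [part_fact mu] is nonzero. *)
Lemma h_series_degree (mu : seq nat) (m : monomial) :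
  mdegree m != sumn mu -> h_series mu m = 0.
Proof.
move=> m_mu; apply: (@mulfI _ ((part_fact mu)%:R : rat)).
  rewrite pnatr_eq0 -lt0n /part_fact; apply: prodn_gt0 => j; exact: fact_gt0.
rewrite mulr0 -sum_mult_fact_block_word big1_seq // => v /andP[_].
by rewrite mem_permutations => /perm_size ->; rewrite (negPf m_mu).
Qed.

(** * Finite expansion of symmetric functions in the monomial basis *)

Lemma Lambda_sumE (I : Type) (r : seq I) (F : I -> Lambda) (m : monomial) :
  (\sum_(i <- r) F i : Lambda) m = \sum_(i <- r) F i m.
Proof. exact: (big_morph (fun f : Lambda => f m)). Qed.

Lemma Pi_sumE (I : Type) (r : seq I) (P : pred I) (F : I -> Pi) (w : word) :
  (\sum_(i <- r | P i) F i : Pi) w = \sum_(i <- r | P i) F i w.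
Proof. exact: (big_morph (fun f : Pi => f w)). Qed.

Lemma Lambda_symmetric (f : Lambda) (m m' : monomial) :
  exponents m = exponents m' -> f m = f m'.
Proof.
move=> /exponents_eqP[s s_bij <-]; have /asboolP[_ f_sym] := LambdaP f.
exact/esym/f_sym.
Qed.

(** A partition of at most [d] has at most [d] parts, each at most [d], so bounded sequences over
    ['I_d.+1] cover all of them. *)
Definition intparts_upto d : seq (seq nat) :=
  [seq la <- [seq [seq val i | i <- (t : seq _)] | t : d.-bseq 'I_d.+1] |
    is_intpart (sumn la) la && (sumn la <= d)%N].

Lemma intparts_upto_uniq d : uniq (intparts_upto d).
Proof.
rewrite filter_uniq // map_inj_uniq ?enum_uniq //.
by move=> s t /(inj_map val_inj) /val_inj.
Qed.

Lemma mem_intparts_upto d n la :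
  is_intpart n la -> (la \in intparts_upto d) = (n <= d)%N.
Proof.
move=> la_n; case/and3P: (la_n) => la_sorted la0 /eqP n_la.
rewrite mem_filter n_la la_n /=; case: (leqP n d) => //= nd.
have bnd k : k \in la -> (k < d.+1)%N.
  move=> kla; rewrite ltnS; apply: leq_trans nd; rewrite -n_la sumnE.
  by rewrite (big_rem k) //= leq_addr.
have sz : (size la <= d)%N.
  apply: leq_trans nd; rewrite -n_la sumnE -sum1_size big_seq [leqRHS]big_seq.
  by apply: leq_sum => k kla; rewrite lt0n; apply: contraNneq la0 => <-.
have sz' : (size [seq inord k : 'I_d.+1 | k <- la] <= d)%N by rewrite size_map.
apply/mapP; exists (Bseq sz'); first by rewrite mem_enum.
rewrite /= -map_comp -[LHS]map_id; apply/eq_in_map => k /bnd kd.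
by rewrite /= inordK.
Qed.

(** The coefficient of [m_sym la] is read off at one monomial with exponents [la]. The degree bound
    keeps the sum finite, so that linear maps can be applied to it. *)
Lemma Lambda_expansion d (f : Lambda) :
  (forall m : monomial, (d < mdegree m)%N -> f m = 0) ->
  f = \sum_(la <- intparts_upto d) f (seq_mset (block_word la)) *: m_sym la.
Proof.
move=> fd; apply/val_inj/funext => m; rewrite [RHS]Lambda_sumE.
have mE := mem_intparts_upto d (exponents_intpart m).
transitivity (\sum_(la <- intparts_upto d)
  f (seq_mset (block_word la)) * (exponents m == la)%:R); last by [].
case: (leqP (mdegree m) d) mE => [md|/[dup] md /fd fm0] mE.
  rewrite (bigD1_seq (exponents m)) ?intparts_upto_uniq //= eqxx mulr1.
  rewrite big1 ?addr0; last by move=> la; rewrite eq_sym => /negPf->; rewrite mulr0.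
  by apply: Lambda_symmetric; rewrite (exponents_block_word (exponents_intpart m)).
rewrite big1_seq // => la /andP[_ la_in]; case: eqP => [mla|_]; last by rewrite mulr0.
by rewrite mla la_in in mE.
Qed.

(** * The symmetric group acting on the positions of words *)

Definition perm_word n (s : 'S_n) (w : word) : word :=
  [seq nth 0%N w (s i) | i <- enum 'I_n].

Lemma size_perm_word n (s : 'S_n) w : size (perm_word s w) = n.
Proof. by rewrite size_map size_enum_ord. Qed.

Lemma nth_perm_word n (s : 'S_n) w (i : 'I_n) :
  nth 0%N (perm_word s w) i = nth 0%N w (s i).
Proof. by rewrite (nth_map i) ?size_enum_ord // nth_ord_enum. Qed.

Lemma perm_eq_perm_wordP n (v w : word) : size w = n ->
  reflect (exists s : 'S_n, v = perm_word s w) (perm_eq v w).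
Proof.
move=> /eqP wn; apply: (iffP (@tuple_permP _ _ v (Tuple wn))) => -[s ->]; exists s.
  by rewrite /=; apply: eq_map => i; rewrite (tnth_nth 0%N).
by rewrite /=; apply: eq_map => i; rewrite (tnth_nth 0%N).
Qed.

Lemma perm_word_eqP n (s t : 'S_n) w :
  reflect (forall i : 'I_n, nth 0 w (s i) = nth 0 w (t i))%N
    (perm_word s w == perm_word t w).
Proof.
apply: (iffP eqP) => [st i|st]; first by rewrite -!nth_perm_word st.
exact: eq_map.
Qed.

Lemma sum_perm_word n (w : word) (V : nmodType) (G : word -> V) : size w = n ->
  (\sum_(s : 'S_n) G (perm_word s w)) *+ size (permutations w) =
  (\sum_(v <- permutations w) G v) *+ n`!.
Proof.
move=> wn; apply: (@sum_perm_fibers_avg n _ V (fun s => perm_word s w) (permutations w) G).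
- move=> s t; apply/perm_word_eqP/perm_word_eqP => st i.
    by rewrite permM perm1 st permKV.
  by have := st (t i); rewrite permM permK perm1.
- exact: permutations_uniq.
move=> v; rewrite mem_permutations; exact: perm_eq_perm_wordP.
Qed.

Definition set_part_of_type n (la : seq nat) : pred {set {set 'I_n}} :=
  fun P => is_set_partition P && (set_part_type P == la).

(** Set partitions of one type form one orbit. If [P] is the kernel of [v], equality of types gives
    a renaming of variables taking [v] to a rearrangement of [u], and renaming does not change the
    kernel. *)
Lemma set_part_of_typeP n (u : word) (P : {set {set 'I_n}}) : size u = n ->
  reflect (exists s : 'S_n, P = word_ker n (perm_word s u))
    (set_part_of_type (exponents (seq_mset u)) P).
Proof.
move=> un; apply: (iffP andP) => [[P_part /eqP P_type]|[s ->]]; last first.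
  split; first exact: word_ker_set_partition.
  rewrite set_part_type_word_ker ?size_perm_word //; apply/eqP; congr exponents.
  by apply/eq_seq_msetP/(perm_eq_perm_wordP _ un); exists s.
have [v vn vP] := exists_word_ker P_part.
move: P_type; rewrite -vP set_part_type_word_ker // => /exponents_eqP[f f_bij fvu].
have /(perm_eq_perm_wordP _ un)[s sE] : perm_eq [seq f x | x <- v] u.
  apply/eq_seq_msetP; rewrite -fvu; apply/eq_seq_msetP/perm_map.
  by rewrite perm_sym; exact: perm_eq_seq_mset.
by exists s; rewrite -sE word_ker_map //; exact: bij_inj.
Qed.

Lemma sum_word_ker_perm_word n (u : word) (V : nmodType)
    (F : {set {set 'I_n}} -> V) : size u = n ->
  let type_u := set_part_of_type (n := n) (exponents (seq_mset u)) in
  (\sum_(s : 'S_n) F (word_ker n (perm_word s u))) *+ #|type_u| =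
  (\sum_(P | type_u P) F P) *+ n`!.
Proof.
move=> un type_u; rewrite cardE -[\sum_(P | type_u P) _](big_enum _ _ type_u).
apply: (@sum_perm_fibers_avg n _ V (fun s => word_ker n (perm_word s u))
  (enum type_u) F).
- move=> s t; apply/word_ker_eqP/word_ker_eqP => st i j.
    by have := st (t^-1 i)%g (t^-1 j)%g; rewrite !nth_perm_word !permM !perm1 !permKV.
  by have := st (t i) (t j); rewrite !nth_perm_word !permM !perm1 !permK.
- exact: enum_uniq.
move=> P; rewrite mem_enum; exact: set_part_of_typeP.
Qed.

(** Reindexing positions moves a permutation from one word of the pair to its inverse on the
    other. *)
Lemma perm_zip_perm_word n (s : 'S_n) (w u : word) : size w = n -> size u = n ->
  perm_eq (zip w (perm_word s u)) (zip (perm_word s^-1%g w) u).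
Proof.
move=> wn un; rewrite -{1}(map_nth_enum_ord 0%N wn) -{2}(map_nth_enum_ord 0%N un).
rewrite !zip_map; have -> : [seq (nth 0%N w i, nth 0%N u (s i)) | i : 'I_n <- enum 'I_n] =
    [seq (nth 0%N w (s^-1%g i), nth 0%N u i) | i : 'I_n <- [seq s i | i <- enum 'I_n]].
  by rewrite -[RHS]map_comp; apply: eq_map => i /=; rewrite permK.
apply/perm_map/uniq_perm => [||i]; rewrite ?enum_uniq //.
  by rewrite map_inj_uniq ?enum_uniq //; exact: perm_inj.
by rewrite mem_enum -[i](permKV s) map_f ?mem_enum.
Qed.

(** * Coefficients of the lift, and the lifts of complete homogeneous functions *)

Definition is_lifting (rho : {linear Lambda -> Pi}) : Prop :=
  forall (n : nat) (la : seq nat), is_intpart n la ->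
  rho (m_sym la) = ((part_fact la)%:R / (n`!)%:R) *:
    \sum_(P : {set {set 'I_n}} |
          is_set_partition P && (set_part_type P == la)) m_nc P.

Lemma permutations_neq0 (w : word) : (size (permutations w))%:R != 0 :> rat.
Proof.
rewrite pnatr_eq0; apply: contraTneq (fact_gt0 (size w)).
by rewrite -size_permutations_mult_fact => ->.
Qed.

(** Only the kernel of [w] contributes to the coefficient at [w]. When its type is [la],
    [part_fact la] is [mult_fact w], and the quotient by [n!] is the inverse of the number of
    rearrangements. *)
Lemma lift_m_coef rho n la (w : word) : is_lifting rho -> is_intpart n la ->
  rho (m_sym la) w = m_sym la (seq_mset w) / (size (permutations w))%:R.
Proof.
move=> rho_m la_n; rewrite (rho_m _ _ la_n).
transitivity ((part_fact la)%:R / n`!%:R * (\sum_(P : {set {set 'I_n}} |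
    is_set_partition P && (set_part_type P == la)) m_nc P : Pi) w); first by [].
have n_la : sumn la = n by case/and3P: la_n => _ _ /eqP.
rewrite Pi_sumE /= /mP_series /m_series; case: (size w =P n) => [wn|wn]; last first.
  rewrite big1 // mulr0; case: eqP => [wla|_]; last by rewrite mul0r.
  by case: wn; rewrite -n_la -wla -mdegree_exponents mdegree_seq_mset.
rewrite -(set_part_type_word_ker wn).
transitivity ((part_fact la)%:R / n`!%:R * (set_part_type (word_ker n w) == la)%:R : rat).
  congr (_ * _); case: (boolP (_ == la)) => [w_la|w_la].
    rewrite (bigD1 (word_ker n w)) ?w_la ?word_ker_set_partition //= eqxx.
    by rewrite big1 ?addr0 // => P /andP[_]; rewrite eq_sym => /negPf->.
  rewrite big1 // => P /andP[_ P_la]; case: eqP => // PE.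
  by rewrite PE P_la in w_la.
rewrite mulrC; case: eqP => [<-|_]; last by rewrite !mul0r.
rewrite set_part_type_word_ker // part_fact_exponents !mul1r.
rewrite -wn -size_permutations_mult_fact natrM invfM mulrCA divff ?mulr1 //.
have := fact_gt0 (size w); rewrite -size_permutations_mult_fact pnatr_eq0 muln_gt0.
by case/andP=> _; rewrite lt0n.
Qed.

Lemma lift_coef rho (f : Lambda) (w : word) : is_lifting rho ->
  rho f w = f (seq_mset w) / (size (permutations w))%:R.
Proof.
move=> rho_m; have /asboolP[[d fd] _] := LambdaP f; rewrite (Lambda_expansion fd).
rewrite linear_sum Pi_sumE Lambda_sumE mulr_suml; apply: eq_big_seq => la.
rewrite mem_filter => /andP[/andP[la_int _] _].
rewrite linearZ; set c := f _.
transitivity (c * rho (m_sym la) w); first by [].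
by rewrite (lift_m_coef w rho_m la_int) mulrA.
Qed.

Lemma card_set_part_of_type_gt0 n mu : is_intpart n mu ->
  (0 < #|set_part_of_type (n := n) mu|)%N.
Proof.
move=> mu_n; have mun : size (block_word mu) = n.
  by rewrite size_block_word; case/and3P: mu_n => _ _ /eqP.
apply/card_gt0P; exists (word_ker n (block_word mu)); rewrite unfold_in /set_part_of_type.
by rewrite word_ker_set_partition set_part_type_word_ker // (exponents_block_word mu_n) /=.
Qed.

(* Both sides are invariant under permuting the positions of a word, and have
   proportional images in Lambda when positions are forgotten. *)
Lemma lift_h rho n mu : is_lifting rho -> is_intpart n mu ->
  ((part_fact mu)%:R * #|set_part_of_type (n := n) mu|%:R) *: rho (h_sym mu) =
  \sum_(P | set_part_of_type (n := n) mu P) h_nc P.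
Proof.
move=> rho_m mu_n; have n_mu : sumn mu = n by case/and3P: mu_n => _ _ /eqP.
apply/val_inj/funext => w; rewrite [RHS]Pi_sumE.
set N := #|_|; transitivity ((part_fact mu)%:R * N%:R * rho (h_sym mu) w); first by [].
rewrite lift_coef //=; case: (size w =P n) => [wn|/eqP wn]; last first.
  rewrite h_series_degree ?mdegree_seq_mset ?n_mu // mul0r mulr0.
  by rewrite big1 // => P _; rewrite /hP_series (negPf wn).
have un : size (block_word mu) = n by rewrite size_block_word.
pose G (v : word) : rat := (mult_fact (zip v (block_word mu)))%:R.
have lhsE : (\sum_(v <- permutations w) G v) = (part_fact mu)%:R * h_series mu (seq_mset w).
  rewrite -sum_mult_fact_block_word (perm_big _ (perm_permutations (perm_eq_seq_mset w))).
  rewrite /=; apply: eq_big_seq => v; rewrite mem_permutations => /perm_size vw.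
  by rewrite vw wn n_mu eqxx.
have sumE : \sum_(s : 'S_n) hP_series (word_ker n (perm_word s (block_word mu))) w =
    \sum_(s : 'S_n) G (perm_word s w).
  (* Inverting the summation index compensates for the inverse that arises when the permutation
     passes from the block word to [w]. *)
  rewrite (reindex_inj invg_inj) /=; apply: eq_bigr => s _.
  rewrite hP_series_word_ker ?size_perm_word //.
  by rewrite (perm_mult_fact (perm_zip_perm_word _ wn un)) invgK.
have := sum_word_ker_perm_word (fun P => hP_series P w) un.
rewrite (exponents_block_word mu_n) /= -/N sumE => avgP.
have := sum_perm_word G wn; rewrite lhsE => avgw.
have n0 : n`!%:R != 0 :> rat by rewrite pnatr_eq0 -lt0n fact_gt0.
(* With the factors [n!] and the number of rearrangements, both averaging identities for the sum [S]
   over the group can be substituted. *)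
apply: (mulfI (mulf_neq0 n0 (permutations_neq0 w))).
set X : rat := \sum_(P | _) _.
set S := (\sum_(s : 'S_n) G _) in avgP avgw.
have {}avgP : S * N%:R = X * n`!%:R by rewrite !mulr_natr; exact: avgP.
have {}avgw : S * (size (permutations w))%:R =
    (part_fact mu)%:R * h_series mu (seq_mset w) * n`!%:R by rewrite !mulr_natr.
have -> : n`!%:R * (size (permutations w))%:R * X = X * n`!%:R * (size (permutations w))%:R.
  by ring.
rewrite -avgP [RHS]mulrAC avgw; field; exact: permutations_neq0.
Qed.

Theorem theorem4p3
  (rho : {linear Lambda -> Pi})
  (rho_m : forall (n : nat) (la : seq nat), is_intpart n la ->
     rho (m_sym la) = ((part_fact la)%:R / (n`!)%:R) *:
       \sum_(P : {set {set 'I_n}} |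
             is_set_partition P && (set_part_type P == la)) m_nc P)
  (formL : {biscalar Lambda})
  (formL_mh : forall (n k : nat) (la mu : seq nat),
     is_intpart n la -> is_intpart k mu ->
     formL (m_sym la) (h_sym mu) = (la == mu)%:R)
  (formP : {biscalar Pi})
  (formP_mh : forall (n : nat) (P Q : {set {set 'I_n}}),
     is_set_partition P -> is_set_partition Q ->
     formP (m_nc P) (h_nc Q) = (n`!)%:R * (P == Q)%:R)
  (formP_mh_neq : forall (n k : nat)
       (P : {set {set 'I_n}}) (Q : {set {set 'I_k}}),
     n != k -> is_set_partition P -> is_set_partition Q ->
     formP (m_nc P) (h_nc Q) = 0) :
  forall f g : Lambda, formL f g = formP (rho f) (rho g).
Proof.
have formP_mh_type n k la mu : is_intpart n la -> is_intpart k mu ->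
    formP (rho (m_sym la)) (rho (h_sym mu)) = (la == mu)%:R.
  move=> la_n mu_k; set N := #|set_part_of_type (n := k) mu|.
  have N0 : (part_fact mu)%:R * N%:R != 0 :> rat.
    rewrite mulf_neq0 // pnatr_eq0 -lt0n ?card_set_part_of_type_gt0 //.
    by apply: prodn_gt0 => j; exact: fact_gt0.
  (* The factor [part_fact mu * N] turns the lift of [h_sym mu] into the plain sum of the [h_nc Q]
     over [Q] of type [mu], to which the duality in [Pi] applies. *)
  apply: (mulfI N0); rewrite -linearZr_LR (lift_h rho_m mu_k) (rho_m n la la_n) linearZl_LR.
  rewrite linear_sumlz /=; case: (la =P mu) => [la_mu|/eqP la_mu]; last first.
    rewrite big1 ?mulr0 // => P /andP[P_part /eqP P_la]; rewrite linear_sumr.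
    apply: big1 => Q /andP[Q_part /eqP Q_mu]; have [nk|/formP_mh_neq->//] := eqVneq n k.
    case: k / nk Q Q_part Q_mu {mu_k N N0} => Q Q_part Q_mu.
    rewrite formP_mh //; case: eqP => [PQ|_]; last by rewrite mulr0.
    by rewrite -P_la -Q_mu PQ eqxx in la_mu.
  have nk : n = k.
    by case/and3P: la_n mu_k => _ _ /eqP <- /and3P[_ _ /eqP <-]; rewrite la_mu.
  case: k / nk @N N0 mu_k => N N0 mu_n; rewrite -la_mu in N N0 mu_n *.
  (* Each [P] of type [la] pairs only with [Q = P], giving [n!]. This cancels the denominator in the
     lift of [m_sym la], and the number of such [P] supplies the factor [N]. *)
  transitivity ((part_fact la)%:R / n`!%:R *
      \sum_(P in set_part_of_type (n := n) la) n`!%:R : rat).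
    congr (_ * _); apply: eq_bigr => P /[dup] P_type /andP[P_part _].
    rewrite linear_sumr (bigD1 P) //= formP_mh // eqxx mulr1 big1 ?addr0 //.
    move=> Q /andP[/andP[Q_part _]]; rewrite formP_mh // eq_sym => /negPf->.
    by rewrite mulr0.
  rewrite sumr_const -[n`!%:R *+ _]mulr_natr mulrA divfK ?mulr1 //.
  by rewrite pnatr_eq0 -lt0n fact_gt0.
move=> f g.
have /asboolP[[df fd] _] := LambdaP f; have /asboolP[[dg gd] _] := LambdaP g.
(* One degree bound for [f] and [g] reduces the claim to the finitely many [m_sym la] indexed by
   [r]. *)
pose d := maxn df dg.
have [fd' gd'] : (forall m : monomial, (d < mdegree m)%N -> f m = 0) /\
    (forall m : monomial, (d < mdegree m)%N -> g m = 0).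
  by split=> m; rewrite gtn_max => /andP[? ?]; [exact: fd|exact: gd].
pose r := intparts_upto d.
pose M (i : 'I_(size r)) := m_sym (nth [::] r i).
have r_int (i : 'I_(size r)) : is_intpart (sumn (nth [::] r i)) (nth [::] r i).
  by have := mem_nth [::] (ltn_ord i); rewrite mem_filter => /andP[/andP[]].
have r_d (i : 'I_(size r)) : (sumn (nth [::] r i) <= d)%N.
  by have := mem_nth [::] (ltn_ord i); rewrite mem_filter => /andP[/andP[]].
have expand (h : Lambda) : (forall m : monomial, (d < mdegree m)%N -> h m = 0) ->
    h = \sum_(i < size r) h (seq_mset (block_word (nth [::] r i))) *: M i.
  by move=> hd; rewrite {1}(Lambda_expansion hd) (big_nth [::]) big_mkord.
(* The transition matrix from monomial to complete homogeneous functions, with entries read at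
   representative monomials. *)
pose A : 'M[rat]_(size r) :=
  \matrix_(i, j) h_sym (nth [::] r i) (seq_mset (block_word (nth [::] r j))).
have hE (i : 'I_(size r)) : h_sym (nth [::] r i) = \sum_j A i j *: M j.
  under eq_bigr do rewrite mxE; apply: expand => m dm.
  by rewrite /= h_series_degree // gtn_eqF // (leq_ltn_trans (r_d i)).
have deltaE (i j : 'I_(size r)) : (nth [::] r i == nth [::] r j) = (i == j).
  by rewrite nth_uniq ?intparts_upto_uniq.
(* Expanding [h_sym] in the second argument turns the duality into a matrix identity. Only linearity
   in that argument is required, so the claim covers both [formL] and the form pulled back along
   [rho]. *)
have gram (F : Lambda -> Lambda -> rat) : 
    (forall (u : Lambda) c (G : 'I_(size r) -> Lambda),
       F u (\sum_j c j *: G j) = \sum_j c j * F u (G j)) ->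
    (forall i j : 'I_(size r), F (M i) (h_sym (nth [::] r j)) = (i == j)%:R) ->
    (\matrix_(i, j) F (M i) (M j)) *m A^T = 1%:M.
  move=> F_lin F_delta; apply/matrixP => i j; rewrite !mxE -F_delta hE F_lin.
  by apply: eq_bigr => l _; rewrite !mxE mulrC.
pose FP (u v : Lambda) := formP (rho u) (rho v).
(* Both Gram matrices on the m_la are right inverses of A^T, hence equal. *)
have gramL : (\matrix_(i, j) formL (M i) (M j)) *m A^T = 1%:M.
  apply: gram => [u c G|i j]; last by rewrite (formL_mh _ _ _ _ (r_int i) (r_int j)) deltaE.
  by rewrite linear_sumr; apply: eq_bigr => j _; rewrite linearZr_LR.
have gramP : (\matrix_(i, j) FP (M i) (M j)) *m A^T = 1%:M.
  apply: gram => [u c G|i j]; last first.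
    by rewrite /FP (formP_mh_type _ _ _ _ (r_int i) (r_int j)) deltaE.
  by rewrite /FP linear_sum linear_sumr; apply: eq_bigr => j _; rewrite linearZ linearZr_LR.
have LP i j : formL (M i) (M j) = formP (rho (M i)) (rho (M j)).
  have E : \matrix_(i, j) formL (M i) (M j) = \matrix_(i, j) FP (M i) (M j).
    by rewrite -[LHS]mulmx1 -(mulmx1C gramP) mulmxA gramL mul1mx.
  by have /matrixP/(_ i j) := E; rewrite !mxE.
rewrite (expand f fd') (expand g gd') !(linear_sum rho) !linear_sumlz.
apply: eq_bigr => i _.
rewrite !linear_sumr; apply: eq_bigr => j _.
by rewrite !(linearZZ rho) !linearZl_LR !linearZr_LR LP.
Qed.
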